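(* Let $\mathscr A$ be a strongly subconvex $L^p$-set for some real number $p$ with $1<p<2$. Then, for all sufficiently large real $N$ and every natural number $q$, one has \[ \frac1q\sum_{a=1}^q\Bigl|\sum_{n\in\mathscr A(N)}e(na/q)\Bigr|^p\ll N^{p-1}+N^p/q, \] with implied constant depending at most on $p$ and $\mathscr A$.
   Context: For $\mathscr A\subseteq\mathbb N$ and $N\geq 1$ write $\mathscr A(N)=\mathscr A\cap[1,N]$ and $A(N)=\mathrm{card}(\mathscr A(N))$; $e(z)=e^{2\pi i z}$. For $p>0$ put $I_p(N;\mathscr A)=\int_0^1\bigl|\sum_{n\in\mathscr A(N)}e(n\alpha)\bigr|^p\,d\alpha$. A non-empty set $\mathscr A\subseteq\mathbb N$ is a strongly subconvex $L^p$-set if $0<p<2$ and, for all real $N$ sufficiently large in terms of $p$, $I_p(N;\mathscr A)\ll N^{-1}A(N)^p$ with implied constant independent of $N$. *)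

(* Defs.v *)
From mathcomp Require Import all_boot all_order all_algebra.
From mathcomp Require Import finmap complex.
From mathcomp Require Import all_classical all_reals all_analysis.

Set Implicit Arguments.
Unset Strict Implicit.
Unset Printing Implicit Defensive.

Import Order.TTheory GRing.Theory Num.Theory.
Import numFieldNormedType.Exports.

Local Open Scope classical_set_scope.
Local Open Scope ring_scope.

Definition expi2pi (R : realType) (x : R) : R[i] :=
  Complex (cos (2 * pi * x)) (sin (2 * pi * x)).

(* The modulus as an element of R; the norm `|z| of R[i] is valued in R[i]. *)
Definition cmod (R : realType) (z : R[i]) : R := ComplexField.Normc.normc z.

Definition truncate (R : realType) (A : set nat) (N : R) : set nat :=
  A `&` [set n | 1 <= (n%:R : R) <= N].

Definition counting_fun (R : realType) (A : set nat) (N : R) : nat :=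
  #|` fset_set (truncate A N)|.

Definition expsum (R : realType) (A : set nat) (N alpha : R) : R[i] :=
  \sum_(n \in truncate A N) expi2pi (n%:R * alpha).

Definition mean_value (R : realType) (p : R) (A : set nat) (N : R) : R :=
  \int[@lebesgue_measure R]_(alpha in `[0, 1]) (cmod (expsum A N alpha) `^ p).

Definition strongly_subconvex (R : realType) (p : R) (A : set nat) : Prop :=
  [/\ A !=set0, 0 < p < 2 &
    exists C : R, \forall N \near +oo,
      mean_value p A N <= C * (N^-1 * (counting_fun A N)%:R `^ p)].

(* Main.v *)
(** Let V(y) = M^-1 conj(D_M(y)) D_2M(y), with D_L the Dirichlet kernel of length L
    and M the integer part of N.  The Fourier coefficients of V at 0, ..., M are 1,
    so the exponential sum f satisfies f(x) = int f(t) V(x - t) dt, and by AM-GM |V|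
    is at most W = (|D_M|^2 + |D_2M|^2) / (2 M), which has integral 3/2.  By
    orthogonality of the additive characters mod q, the sum of W(a/q - t) over a is
    at most (5 M + 3 q) / 2, uniformly in t.  Young's inequality then
    yields the large sieve inequality
    sum_a |f(a/q)|^p << (N + q) int |f|^p, and the right-hand side is
    << (N + q) N^(p-1) because f has at most N terms. *)
Require Import Defs.
From mathcomp Require Import all_boot all_order all_algebra.
From mathcomp Require Import complex.
From mathcomp Require Import all_classical all_reals all_analysis.
From mathcomp Require Import ring lra.

Set Implicit Arguments.
Unset Strict Implicit.
Unset Printing Implicit Defensive.

Import Order.TTheory GRing.Theory Num.Theory.
Import numFieldNormedType.Exports.

Local Open Scope classical_set_scope.
Local Open Scope ring_scope.

(** * Additive characters and the complex modulus *)

Lemma expi2piD (R : realType) (x y : R) :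
  expi2pi (x + y) = expi2pi x * expi2pi y.
Proof.
rewrite /expi2pi mulrDr cosD sinD; apply/eqP; rewrite eq_complex /= eqxx /=.
by apply/eqP; ring.
Qed.

Lemma expi2piN (R : realType) (x : R) : expi2pi (- x) = (expi2pi x)^*%C.
Proof. by rewrite /expi2pi mulrN cosN sinN. Qed.

Lemma expi2pi0 (R : realType) : expi2pi (0 : R) = 1.
Proof. by rewrite /expi2pi mulr0 cos0 sin0. Qed.

Lemma cmod_expi2pi (R : realType) (x : R) : cmod (expi2pi x) = 1.
Proof. by rewrite /cmod /= cos2Dsin2 sqrtr1. Qed.

Lemma cmodM (R : realType) (z w : R[i]) : cmod (z * w) = cmod z * cmod w.
Proof. exact: ComplexField.Normc.normcM. Qed.

Lemma cmod_ge0 (R : realType) (z : R[i]) : 0 <= cmod z.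
Proof. by case: z => a b; apply: sqrtr_ge0. Qed.

Lemma sqr_cmod (R : realType) (z : R[i]) : cmod z ^+ 2 = complex.Re (z * z^*%C).
Proof.
case: z => a b; rewrite /cmod /= sqr_sqrtr; last by rewrite addr_ge0 ?sqr_ge0.
by ring.
Qed.

Lemma cmodJ (R : realType) (z : R[i]) : cmod (z^*%C) = cmod z.
Proof. by case: z => a b; rewrite /cmod /= sqrrN. Qed.

Lemma Re_le_cmod (R : realType) (z : R[i]) : complex.Re z <= cmod z.
Proof.
case: z => a b; rewrite /cmod /=; apply: (le_trans (ler_norm a)).
by rewrite -sqrtr_sqr ler_wsqrtr // lerDl sqr_ge0.
Qed.

Lemma ReD (R : realType) (z w : R[i]) : complex.Re (z + w) = complex.Re z + complex.Re w.
Proof. by case: z; case: w. Qed.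

Lemma Re_sum (R : realType) (I : Type) (r : seq I) (P : pred I) (F : I -> R[i]) :
  complex.Re (\sum_(i <- r | P i) F i) = \sum_(i <- r | P i) complex.Re (F i).
Proof.
exact: (big_morph (@complex.Re R) (@ReD R) (erefl : complex.Re (0 : R[i]) = 0)).
Qed.

Lemma cmod_real (R : realType) (x : R) : 0 <= x -> cmod (x%:C)%C = x.
Proof. by move=> x0; rewrite /cmod /= expr0n /= addr0 sqrtr_sqr ger0_norm. Qed.

(** Take the conjugate of z over its modulus, or 1 at z = 0. Such a [c] turns a modulus into the
    real part of a linear expression, so only real-valued functions need to be integrated later. *)
Lemma cmod_phase (R : realType) (z : R[i]) :
  exists2 c : R[i], cmod c = 1 & complex.Re (c * z) = cmod z.
Proof.
have [z0|z0] := eqVneq (cmod z) 0.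
  exists 1; first exact: ComplexField.Normc.normc1.
  rewrite mul1r z0; have -> : z = 0 by exact: ComplexField.Normc.eq0_normc.
  by [].
exists (((cmod z)^-1)%:C%C * z^*%C).
  rewrite cmodM cmodJ cmod_real ?invr_ge0 ?cmod_ge0 //; exact: mulVf.
rewrite -mulrA [_^*%C * _]mulrC.
have -> : complex.Re ((cmod z)^-1%:C%C * (z * z^*%C)) =
    (cmod z)^-1 * complex.Re (z * z^*%C).
  by rewrite /complex.Re; case: (_ * _^*%C) => a b /=; rewrite mul0r subr0.
by rewrite -sqr_cmod expr2 mulrA mulVf // mul1r.
Qed.

Lemma expi2pi_nat (R : realType) (n : nat) (x : R) :
  expi2pi (n%:R * x) = expi2pi x ^+ n.
Proof.
elim: n => [|n IH]; first by rewrite mul0r expi2pi0 expr0.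
by rewrite -addn1 natrD mulrDl mul1r expi2piD IH exprD expr1.
Qed.

Lemma expi2pi1 (R : realType) : expi2pi (1 : R) = 1.
Proof. by rewrite /expi2pi mulr1 mulr_natl cos2pi sin2pi. Qed.

Lemma expi2pi_natr (R : realType) (n : nat) : expi2pi (n%:R : R) = 1.
Proof. by rewrite -[n%:R]mulr1 expi2pi_nat expi2pi1 expr1n. Qed.

(** Equal real parts would give cos(2 pi x) = 1, hence cos(pi x)^2 = 1, while sin(pi x) > 0 on the
    open interval. *)
Lemma expi2pi_neq1 (R : realType) (x : R) : 0 < x < 1 -> expi2pi x != 1.
Proof.
move=> /andP[x0 x1]; apply/eqP => -[+ _].
rewrite -mulrA mulr_natl cos_mulr2n => h.
have s0 : 0 < sin (pi * x).
  apply: sin_gt0_pi; rewrite mulr_gt0 ?pi_gt0 //=.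
  by rewrite -{2}(mulr1 pi) ltr_pM2l // pi_gt0.
have := cos2Dsin2 (pi * x); have : 0 < sin (pi * x) ^+ 2 by rewrite exprn_gt0.
by lra.
Qed.

(** * Integrals of characters over the unit interval *)

Lemma Re_char (R : realType) (c : R[i]) (k t : R) :
  complex.Re (c * expi2pi (k * t)) =
  complex.Re c * cos (2 * pi * k * t) - complex.Im c * sin (2 * pi * k * t).
Proof. by rewrite -mulrA -/(_ * pi); case: c => a b; rewrite /expi2pi /= !mulrA. Qed.

Lemma continuous_Re_char (R : realType) (c : R[i]) (k : R) :
  continuous (fun t : R => complex.Re (c * expi2pi (k * t))).
Proof.
move=> t; under eq_fun do rewrite Re_char.
have ck : (2 * pi * k * x) @[x --> t] --> 2 * pi * k * t.
  by apply: cvgM; [exact: cvg_cst|exact: cvg_id].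
apply: cvgB; apply: cvgM; try exact: cvg_cst.
  exact: (continuous_cvg _ (@continuous_cos R _) ck).
exact: (continuous_cvg _ (@continuous_sin R _) ck).
Qed.

Lemma continuous_integrable01 (R : realType) (g : R -> R) : continuous g ->
  (@lebesgue_measure R).-integrable `[0, 1] (EFin \o g).
Proof.
move=> cg; apply: continuous_compact_integrable; first exact: segment_compact.
exact: continuous_subspaceT.
Qed.

Lemma Rintegral01_derive (R : realType) (F f : R -> R) :
  (forall x : R, is_derive x (1 : R) F (f x)) -> continuous f ->
  \int[@lebesgue_measure R]_(t in `[0, 1]) f t = F 1 - F 0.
Proof.
move=> dF cf; have cF : continuous F.
  move=> x; apply: differentiable_continuous; apply/derivable1_diffP.
  by case: (dF x).
rewrite /Rintegral (@continuous_FTC2 R f F) //.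
- exact: continuous_subspaceT.
- split.
  + by move=> x _; case: (dF x).
  + by apply: cvg_at_right_filter; apply: cF.
  + by apply: cvg_at_left_filter; apply: cF.
- by move=> x _; rewrite derive1E; apply: derive_val.
Qed.

(** Orthogonality: for n != m the antiderivative takes equal values at 0 and 1, since its frequency
    is a nonzero integer. A difference of naturals covers both signs of the frequency. *)
Lemma Rintegral_Re_char (R : realType) (c : R[i]) (n m : nat) :
  \int[@lebesgue_measure R]_(t in `[0, 1])
     complex.Re (c * expi2pi ((n%:R - m%:R) * t)) = complex.Re c *+ (n == m).
Proof.
have [->|nm] := eqVneq n m.
  under eq_Rintegral do rewrite subrr mul0r expi2pi0 mulr1.
  rewrite Rintegral_cst // [X in fine X](@lebesgue_measure_itv R `[0, 1]).
  by rewrite /= lte_fin ltr01 sube0 mulr1.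
set k : R := n%:R - m%:R.
have k0 : 2 * pi * k != 0.
  by rewrite mulf_neq0 // ?subr_eq0 ?eqr_nat // mulf_neq0 // gt_eqF // pi_gt0.
pose F (t : R) := (2 * pi * k)^-1 *
  (complex.Re c * sin (2 * pi * k * t) + complex.Im c * cos (2 * pi * k * t)).
have dF (t : R) : is_derive t (1 : R) F (complex.Re (c * expi2pi (k * t))).
  rewrite Re_char /F; apply: is_derive_eq.
  rewrite /GRing.scale /= !mulr1 [cos _ * _]mulrC [- sin _ * _]mulrC.
  rewrite !(mulrCA (complex.Re c)) !(mulrCA (complex.Im c)) -mulrDr mulKf //.
  by rewrite mulrN.
rewrite (Rintegral01_derive dF); last exact: continuous_Re_char.
(* Reading e(n - m) as e(n) times the conjugate of e(m) shows that it is 1. *)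
have := expi2piD n%:R (- m%:R : R).
rewrite expi2piN !expi2pi_natr -/k mul1r => -[ck sk].
by rewrite /F !mulr0 !mulr1 ck sk oppr0 sin0 cos0 subrr.
Qed.

Lemma continuous_sum_fun (R : realType) (I : Type) (r : seq I) (F : I -> R -> R) :
  (forall i, continuous (F i)) -> continuous (fun t => \sum_(i <- r) F i t).
Proof.
move=> cF; elim: r => [|i r IH].
  by under eq_fun do rewrite big_nil; exact: cst_continuous.
under eq_fun do rewrite big_cons.
by move=> t; apply: cvgD; [exact: cF|exact: IH].
Qed.

Lemma Rintegral01_sum (R : realType) (I : Type) (r : seq I) (F : I -> R -> R) :
  (forall i, continuous (F i)) ->
  \int[@lebesgue_measure R]_(t in `[0, 1]) (\sum_(i <- r) F i t) =
  \sum_(i <- r) \int[@lebesgue_measure R]_(t in `[0, 1]) F i t.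
Proof.
move=> cF; elim: r => [|i r IH].
  rewrite big_nil; under eq_Rintegral do rewrite big_nil.
  by rewrite Rintegral_cst // mul0r.
rewrite big_cons; under eq_Rintegral do rewrite big_cons.
rewrite RintegralD ?IH //; apply: continuous_integrable01; first exact: cF.
exact: continuous_sum_fun.
Qed.

(** * Mean squares of Dirichlet kernels, discrete and continuous *)

Definition dirichlet (R : realType) (L : nat) (y : R) : R[i] :=
  \sum_(n < L) expi2pi (n%:R * y).

Lemma dirichletN (R : realType) (L : nat) (y : R) :
  dirichlet L (- y) = (dirichlet L y)^*%C.
Proof.
rewrite /dirichlet raddf_sum; apply: eq_bigr => n _.
by rewrite mulrN expi2piN.
Qed.

Lemma sqr_cmod_dirichlet (R : realType) (L : nat) (y : R) :
  cmod (dirichlet L y) ^+ 2 =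
  \sum_(n < L) \sum_(m < L) complex.Re (expi2pi ((n%:R - m%:R) * y)).
Proof.
rewrite sqr_cmod -dirichletN /dirichlet mulr_suml Re_sum.
apply: eq_bigr => n _; rewrite mulr_sumr Re_sum; apply: eq_bigr => m _.
by rewrite -expi2piD mulrN mulrBl.
Qed.

(** Isolates t: the factor in x becomes the constant coefficient of a character in t, as
    [Rintegral_Re_char] requires. *)
Lemma sqr_cmod_dirichletB (R : realType) (L : nat) (x t : R) :
  cmod (dirichlet L (x - t)) ^+ 2 =
  \sum_(n < L) \sum_(m < L) complex.Re
    (expi2pi ((n%:R - m%:R) * x) * expi2pi ((m%:R - n%:R) * t)).
Proof.
rewrite sqr_cmod_dirichlet; apply: eq_bigr => n _; apply: eq_bigr => m _.
by rewrite -expi2piD; congr (complex.Re (expi2pi _)); ring.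
Qed.

Lemma expi2pi_div_modn (R : realType) (q n : nat) : (0 < q)%N ->
  expi2pi (n%:R / q%:R) = expi2pi ((n %% q)%:R / q%:R) :> R[i].
Proof.
move=> q0; rewrite {1}(divn_eq n q) natrD mulrDl expi2piD natrM mulfK.
  by rewrite expi2pi_natr mul1r.
by rewrite pnatr_eq0 -lt0n.
Qed.

(** A geometric sum over a full period, whose ratio z satisfies z^q = 1 and z != 1. *)
Lemma sum_expi2pi_eq0 (R : realType) (q n m : nat) : (0 < q)%N ->
  (n != m %[mod q])%N ->
  \sum_(1 <= a < q.+1) expi2pi ((n%:R - m%:R) * (a%:R / q%:R)) = 0 :> R[i].
Proof.
(* A natural number congruent to n - m mod q, whichever of n and m is larger. *)
move=> q0 nm; pose k := (n + q.-1 * m)%N.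
have qR : q%:R != 0 :> R by rewrite pnatr_eq0 -lt0n.
have kR : k%:R = n%:R - m%:R + q%:R * m%:R :> R.
  by rewrite natrD natrM -{2}(prednK q0) -natr1; ring.
have kq : (0 < k %% q)%N.
  rewrite lt0n; apply: contraNN nm => /eqP k0.
  rewrite -(modnMDl m n q) addnC mulnC -{1}(prednK q0) mulSn addnCA -/k.
  by rewrite -modnDmr k0 addn0.
pose z : R[i] := expi2pi (k%:R / q%:R).
have z1 : z != 1.
  rewrite /z expi2pi_div_modn //; apply: expi2pi_neq1.
  by rewrite divr_gt0 ?ltr0n //= ltr_pdivrMr ?ltr0n // mul1r ltr_nat ltn_mod.
have zq : z ^+ q = 1 by rewrite -expi2pi_nat mulrC divfK // expi2pi_natr.
have za (a : nat) : expi2pi ((n%:R - m%:R) * (a%:R / q%:R)) = z ^+ a.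
  rewrite -expi2pi_nat kR.
  have -> : a%:R * ((n%:R - m%:R + q%:R * m%:R) / q%:R) =
      (n%:R - m%:R) * (a%:R / q%:R) + (a * m)%:R :> R.
    by rewrite natrM; field.
  by rewrite expi2piD expi2pi_natr mulr1.
under eq_bigr do rewrite za.
rewrite big_add1 /= big_mkord.
under eq_bigr do rewrite exprS.
rewrite -mulr_sumr; apply/eqP; rewrite mulf_eq0; apply/orP; right.
have /eqP := subrX1 z q.
by rewrite zq subrr eq_sym mulf_eq0 subr_eq0 (negbTE z1).
Qed.

(** Within one residue class, m is determined by its quotient by q, which is at most L / q. *)
Lemma count_eqmodn (q L n : nat) : (0 < q)%N ->
  (\sum_(m < L) (n == m %[mod q]) <= (L %/ q).+1)%N.
Proof.
move=> q0; rewrite -big_mkcond /= sum1_card -[leqRHS]card_ord.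
have lt_f (m : 'I_L) : (m %/ q < (L %/ q).+1)%N by rewrite ltnS leq_div2r // ltnW.
apply: (@leq_card_in _ _ (fun m : 'I_L => Ordinal (lt_f m))).
move=> m1 m2; rewrite !unfold_in /= => /eqP e1 /eqP e2 [e].
by apply: val_inj; rewrite /= (divn_eq m1 q) (divn_eq m2 q) e -e1 -e2.
Qed.

(** After expanding the square, only pairs congruent mod q survive, each giving at most q. Every n
    has at most L / q + 1 partners (integer quotient), and q times this is at most L + q. *)
Lemma sum_sqr_dirichlet_le (R : realType) (q L : nat) (t : R) : (0 < q)%N ->
  \sum_(1 <= a < q.+1) cmod (dirichlet L (a%:R / q%:R - t)) ^+ 2
    <= L%:R * (L%:R + q%:R).
Proof.
move=> q0.
have step (n m : nat) :
    \sum_(1 <= a < q.+1) complex.Re (expi2pi ((n%:R - m%:R) * (a%:R / q%:R - t)))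
      <= q%:R *+ (n == m %[mod q])%N.
  have [nm|nm] := boolP (n == m %[mod q])%N; last first.
    (* The shift by t only multiplies the vanishing sum by a factor independent of a. *)
    have := sum_expi2pi_eq0 R q0 nm => /(congr1 (fun w =>
      complex.Re (w * expi2pi ((n%:R - m%:R) * - t)))).
    rewrite mulr_suml Re_sum mul0r => h; rewrite mulrb -[leRHS]h.
    by apply: ler_sum => a _; rewrite mulrDr expi2piD.
  rewrite mulrb; apply: (@le_trans _ _ (\sum_(1 <= a < q.+1) 1)).
    by apply: ler_sum => a _; apply: le_trans (Re_le_cmod _) _; rewrite cmod_expi2pi.
  by rewrite big_const_nat iter_addr_0 subn1.
under eq_bigr do rewrite sqr_cmod_dirichlet.
rewrite exchange_big /=.
apply: (@le_trans _ _ (\sum_(n < L) (L%:R + q%:R))); last first.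
  by rewrite sumr_const card_ord [leRHS]mulrC mulr_natr.
apply: ler_sum => n _; rewrite exchange_big /=.
apply: (@le_trans _ _ (\sum_(m < L) q%:R *+ (n == m %[mod q])%N)).
  by apply: ler_sum => m _; exact: step.
rewrite sumrMnr -[leLHS]mulr_natr.
apply: (@le_trans _ _ (q%:R * (L %/ q).+1%:R)).
  by rewrite ler_wpM2l // ler_nat count_eqmodn.
by rewrite -natrM -natrD ler_nat mulnS addnC leq_add2r mulnC leq_divM.
Qed.

Lemma Rintegral_sqr_dirichlet (R : realType) (L : nat) (x : R) :
  \int[@lebesgue_measure R]_(t in `[0, 1]) (cmod (dirichlet L (x - t)) ^+ 2)
  = L%:R.
Proof.
under eq_Rintegral do rewrite sqr_cmod_dirichletB.
rewrite Rintegral01_sum; last first.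
  by move=> n; apply: continuous_sum_fun => m; exact: continuous_Re_char.
under eq_bigr => n _.
  rewrite Rintegral01_sum; last by move=> m; exact: continuous_Re_char.
  under eq_bigr do rewrite Rintegral_Re_char.
  over.
transitivity (\sum_(n < L) 1 : R); last by rewrite sumr_const card_ord.
apply: eq_bigr => n _; rewrite (bigD1 n) // eqxx subrr mul0r expi2pi0.
rewrite big1; first exact: addr0.
by move=> m /negbTE; rewrite -val_eqE /= => ->.
Qed.

(** * Trigonometric polynomials *)

Definition trigpoly (R : realType) (b : nat -> R[i]) (s : seq nat) (t : R) : R[i] :=
  \sum_(k <- s) b k * expi2pi (k%:R * t).

(** The modulus is the square root of a finite sum of real parts of characters. *)
Lemma continuous_cmod_trigpoly (R : realType) (b : nat -> R[i]) (s : seq nat) :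
  continuous (fun t : R => cmod (trigpoly b s t)).
Proof.
have E (t : R) : cmod (trigpoly b s t) = Num.sqrt (\sum_(k <- s) \sum_(l <- s)
    complex.Re (b k * (b l)^*%C * expi2pi ((k%:R - l%:R) * t))).
  rewrite -[LHS]ger0_norm ?cmod_ge0 // -sqrtr_sqr; congr Num.sqrt.
  rewrite sqr_cmod /trigpoly raddf_sum mulr_suml Re_sum.
  apply: eq_bigr => k _; rewrite mulr_sumr Re_sum; apply: eq_bigr => l _.
  by rewrite mulrBl expi2piD expi2piN /= (rmorphM (@conjc R)) mulrACA.
under eq_fun do rewrite E.
move=> t; apply: continuous_cvg; first exact: sqrt_continuous.
by apply: continuous_sum_fun => k; apply: continuous_sum_fun => l;
  apply: continuous_Re_char.
Qed.

Lemma cmod_sum_le (R : realType) (I : Type) (s : seq I) (F : I -> R[i]) :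
  cmod (\sum_(i <- s) F i) <= \sum_(i <- s) cmod (F i).
Proof.
elim: s => [|i s IH]; first by rewrite !big_nil /cmod ComplexField.Normc.normc0.
rewrite !big_cons; apply: le_trans (le_normcD _ _) _.
by rewrite lerD2l.
Qed.

(** Measurable on a set of finite measure, and bounded by the p-th power of the sum of the moduli of
    the coefficients. *)
Lemma integrable_powR_trigpoly (R : realType) (p : R) (b : nat -> R[i])
    (s : seq nat) : 0 <= p ->
  (@lebesgue_measure R).-integrable `[0, 1]
    (EFin \o (fun t => cmod (trigpoly b s t) `^ p)).
Proof.
move=> p0; apply: measurable_bounded_integrable => //.
- rewrite [X in (X < _)%E](@lebesgue_measure_itv R `[0, 1]).
  by rewrite /= lte_fin ltr01 ltry.
- apply: (measurableT_comp (measurable_realfun.measurable_powR p)).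
  apply: measurable_funTS; apply: measurable_realfun.continuous_measurable_fun.
  exact: continuous_cmod_trigpoly.
- exists ((\sum_(k <- s) cmod (b k)) `^ p); split; first exact: num_real.
  move=> y /ltW yB t _; apply: le_trans yB; rewrite ger0_norm ?powR_ge0 //.
  apply: ge0_ler_powR; rewrite ?nnegrE ?cmod_ge0 ?sumr_ge0 //.
    by move=> k _; exact: cmod_ge0.
  apply: le_trans (cmod_sum_le _ _) _; apply: ler_sum => k _.
  by rewrite cmodM cmod_expi2pi mulr1.
Qed.

(** * The reproducing kernel and its majorant *)

(** A kernel of de la Vallée Poussin type, without the normalising factor 1 / M. *)
Definition vp_kernel (R : realType) (M : nat) (y : R) : R[i] :=
  (dirichlet M y)^*%C * dirichlet (2 * M) y.

(** The AM-GM bound for [vp_kernel]. Being built from squares, it has an integral and a discrete sum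
    that follow from orthogonality. *)
Definition vp_majorant (R : realType) (M : nat) (y : R) : R :=
  (cmod (dirichlet M y) ^+ 2 + cmod (dirichlet (2 * M) y) ^+ 2) / 2.

Lemma vp_majorant_ge0 (R : realType) (M : nat) (y : R) : 0 <= vp_majorant M y.
Proof. by rewrite divr_ge0 ?addr_ge0 ?sqr_ge0. Qed.

Lemma cmod_vp_kernel_le (R : realType) (M : nat) (y : R) :
  cmod (vp_kernel M y) <= vp_majorant M y.
Proof.
rewrite cmodM cmodJ /vp_majorant.
have := sqr_ge0 (cmod (dirichlet M y) - cmod (dirichlet (2 * M) y)).
by nra.
Qed.

(** Half of M (M + q) + 2 M (2 M + q), the bounds for lengths M and 2 M. *)
Lemma sum_vp_majorant_le (R : realType) (q M : nat) (t : R) : (0 < q)%N ->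
  \sum_(1 <= a < q.+1) vp_majorant M (a%:R / q%:R - t)
    <= M%:R * ((5 * M%:R + 3 * q%:R) / 2).
Proof.
move=> q0; rewrite -mulr_suml big_split /=.
have := sum_sqr_dirichlet_le M t q0; have := sum_sqr_dirichlet_le (2 * M) t q0.
by rewrite natrM; lra.
Qed.

Lemma continuous_sqr_dirichlet (R : realType) (L : nat) (x : R) :
  continuous (fun t : R => cmod (dirichlet L (x - t)) ^+ 2).
Proof.
under eq_fun do rewrite sqr_cmod_dirichletB.
apply: continuous_sum_fun => n; apply: continuous_sum_fun => m.
exact: continuous_Re_char.
Qed.

Lemma continuous_vp_majorant (R : realType) (M : nat) (x : R) :
  continuous (fun t : R => vp_majorant M (x - t)).
Proof.
move=> t; apply: cvgM; last exact: cvg_cst.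
by apply: cvgD; apply: continuous_sqr_dirichlet.
Qed.

Lemma Rintegral_vp_majorant (R : realType) (M : nat) (x : R) :
  \int[@lebesgue_measure R]_(t in `[0, 1]) vp_majorant M (x - t)
    = M%:R * (3 / 2).
Proof.
have ci L := continuous_integrable01 (@continuous_sqr_dirichlet R L x).
rewrite RintegralZr //; last first.
  apply: continuous_integrable01 => t.
  by apply: cvgD; apply: continuous_sqr_dirichlet.
by rewrite RintegralD // !Rintegral_sqr_dirichlet natrM; field.
Qed.

(** Expands everything into characters of t. At x - t the conjugated kernel contributes frequency n
    and the other one -m, whence k + n - m. *)
Lemma trigpoly_mul_vp (R : realType) (b : nat -> R[i]) (s : seq nat) (c : R[i])
    (M : nat) (x t : R) :
  complex.Re (c * (trigpoly b s t * vp_kernel M (x - t))) =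
  \sum_(k <- s) \sum_(n < M) \sum_(m < 2 * M)
    complex.Re (c * b k * expi2pi ((m%:R - n%:R) * x) *
      expi2pi (((k + n)%:R - m%:R) * t)).
Proof.
rewrite /trigpoly mulr_suml mulr_sumr Re_sum; apply: eq_bigr => k _.
rewrite /vp_kernel -dirichletN /dirichlet mulr_suml !mulr_sumr Re_sum.
apply: eq_bigr => n _; rewrite !mulr_sumr Re_sum; apply: eq_bigr => m _.
congr complex.Re; rewrite -!mulrA; congr (_ * (_ * _)).
by rewrite -!expi2piD; congr expi2pi; rewrite natrD; ring.
Qed.

Lemma continuous_trigpoly_vp (R : realType) (b : nat -> R[i]) (s : seq nat)
    (c : R[i]) (M : nat) (x : R) :
  continuous (fun t : R =>
    complex.Re (c * (trigpoly b s t * vp_kernel M (x - t)))).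
Proof.
under eq_fun do rewrite trigpoly_mul_vp.
apply: continuous_sum_fun => k; apply: continuous_sum_fun => n.
by apply: continuous_sum_fun => m; exact: continuous_Re_char.
Qed.

(** For each k and each of the M values of n, integration keeps only m = k + n, which leaves the
    term of frequency k at x; hence the factor M. *)
Lemma trigpoly_reproducing (R : realType) (b : nat -> R[i]) (s : seq nat)
    (c : R[i]) (M : nat) (x : R) : {in s, forall k, (k <= M)%N} ->
  \int[@lebesgue_measure R]_(t in `[0, 1])
     complex.Re (c * (trigpoly b s t * vp_kernel M (x - t)))
  = M%:R * complex.Re (c * trigpoly b s x).
Proof.
move=> sM; under eq_Rintegral do rewrite trigpoly_mul_vp.
rewrite Rintegral01_sum; last first.
  move=> k; apply: continuous_sum_fun => n.
  by apply: continuous_sum_fun => m; exact: continuous_Re_char.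
rewrite /trigpoly !mulr_sumr Re_sum mulr_sumr; apply: eq_big_seq => k /sM kM.
rewrite Rintegral01_sum; last first.
  by move=> n; apply: continuous_sum_fun => m; exact: continuous_Re_char.
transitivity (\sum_(n < M) complex.Re (c * (b k * expi2pi (k%:R * x)))); last first.
  by rewrite sumr_const card_ord -[LHS]mulr_natl.
apply: eq_bigr => n _.
rewrite Rintegral01_sum; last by move=> m; exact: continuous_Re_char.
under eq_bigr do rewrite Rintegral_Re_char.
(* The length 2 M of the second kernel is chosen for this; since n < M strictly, k = M is
   allowed. *)
have knM : (k + n < 2 * M)%N by rewrite mul2n -addnn -addnS leq_add.
rewrite (bigD1 (Ordinal knM)) // eqxx big1.
  by rewrite [LHS]addr0 natrD addrK mulrA.
by move=> m /negbTE; rewrite -val_eqE /= eq_sym => ->.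
Qed.

(** * The large sieve inequality for p-th powers *)

(** Young's inequality for g and l^(p - 1), with conjugate exponents p and p / (p - 1). *)
Lemma powR_mul_le (R : realType) (p l g : R) : 1 < p -> 0 <= l -> 0 <= g ->
  l `^ (p - 1) * g <= p^-1 * g `^ p + (1 - p^-1) * l `^ p.
Proof.
move=> p1 l0 g0; have p0 : 0 < p by lra.
have pB1 : 0 < p - 1 by lra.
have := @conjugate_powR R g (l `^ (p - 1)) p (p / (p - 1)) g0 (powR_ge0 _ _) p0
  (divr_gt0 p0 pB1).
rewrite -powRrM [(p - 1) * _]mulrC divfK ?gt_eqF // => h.
have -> : 1 - p^-1 = (p / (p - 1))^-1 by field; rewrite !gt_eqF.
rewrite mulrC [p^-1 * _]mulrC [_^-1 * _]mulrC; apply: h.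
by field; rewrite !gt_eqF.
Qed.

Lemma powRB1_mul (R : realType) (p l : R) : 1 < p -> 0 <= l ->
  l `^ (p - 1) * l = l `^ p.
Proof.
move=> p1 l0; rewrite -{2}(powRr1 l0) -powRD ?subrK //.
by apply/implyP => /eqP; lra.
Qed.

(** The reproducing formula at each point is weighted by l_i^(p - 1) and summed. Young's inequality
    bounds the integrand, and the resulting multiple of the sum of l_i^p is absorbed on the left. *)
Lemma sum_powR_trigpoly_le (R : realType) (p B : R) (b : nat -> R[i])
    (s : seq nat) (M : nat) (I : Type) (r : seq I) (x : I -> R) :
  1 < p -> (0 < M)%N -> {in s, forall k, (k <= M)%N} ->
  (forall t, \sum_(i <- r) vp_majorant M (x i - t) <= M%:R * B) ->
  \sum_(i <- r) cmod (trigpoly b s (x i)) `^ p <=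
    (3 / 2) `^ p * (B / (3 / 2)) *
    \int[@lebesgue_measure R]_(t in `[0, 1]) (cmod (trigpoly b s t) `^ p).
Proof.
move=> p1 M0 sM hB; have p0 : 0 < p by lra.
set J := (\int[_]_(t in _) _).
set f := trigpoly b s.
pose c i := s2val (cid2 (cmod_phase (f (x i)))).
have c1 i : cmod (c i) = 1 by rewrite /c; case: cid2.
have cF i : complex.Re (c i * f (x i)) = cmod (f (x i)) by rewrite /c; case: cid2.
(* Dividing by 3/2, the integral of the majorant over M, makes both sides carry the same M (3/2)
   l^p, with coefficient 1 on the left and 1 - 1/p on the right. *)
pose l i := cmod (f (x i)) / (3 / 2).
have l0 i : 0 <= l i by rewrite divr_ge0 ?cmod_ge0.
have MR : 0 < M%:R :> R by rewrite ltr0n.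
have pointwise (t : R) :
    \sum_(i <- r) l i `^ (p - 1) * complex.Re (c i * (f t * vp_kernel M (x i - t)))
    <= M%:R * B / p * cmod (f t) `^ p
       + \sum_(i <- r) (1 - p^-1) * l i `^ p * vp_majorant M (x i - t).
  apply: (@le_trans _ _ (\sum_(i <- r) (p^-1 * cmod (f t) `^ p * vp_majorant M (x i - t)
     + (1 - p^-1) * l i `^ p * vp_majorant M (x i - t)))).
    apply: ler_sum => i _; rewrite -mulrDl.
    apply: (@le_trans _ _ (l i `^ (p - 1) * cmod (f t) * vp_majorant M (x i - t))).
      rewrite -mulrA ler_wpM2l ?powR_ge0 //; apply: le_trans (Re_le_cmod _) _.
      rewrite !cmodM c1 mul1r; apply: ler_wpM2l; first exact: cmod_ge0.
      by rewrite -cmodM; exact: cmod_vp_kernel_le.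
    by apply: ler_wpM2r; [exact: vp_majorant_ge0|exact: powR_mul_le (cmod_ge0 _)].
  rewrite big_split /= lerD2r -mulr_sumr.
  apply: (@le_trans _ _ (p^-1 * cmod (f t) `^ p * (M%:R * B))).
    by rewrite ler_wpM2l // mulr_ge0 ?powR_ge0 // invr_ge0 ltW.
  by rewrite mulrC -mulrA mulrA.
have cL i : continuous (fun t : R => l i `^ (p - 1) *
    complex.Re (c i * (f t * vp_kernel M (x i - t)))).
  by move=> t; apply: cvgM; [exact: cvg_cst|exact: continuous_trigpoly_vp].
have cR i : continuous (fun t : R => (1 - p^-1) * l i `^ p * vp_majorant M (x i - t)).
  by move=> t; apply: cvgM; [exact: cvg_cst|exact: continuous_vp_majorant].
have iJ : (@lebesgue_measure R).-integrable `[0, 1]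
    (EFin \o (fun t => M%:R * B / p * cmod (f t) `^ p)).
  have := integrableZl _ (M%:R * B / p) (integrable_powR_trigpoly b s (ltW p0)).
  by apply.
have iR : (@lebesgue_measure R).-integrable `[0, 1] (EFin \o
    (fun t => \sum_(i <- r) (1 - p^-1) * l i `^ p * vp_majorant M (x i - t))).
  by apply: continuous_integrable01; exact: continuous_sum_fun.
(* The pointwise bound integrated over t: reproducing formula on the left, integral of the majorant
   on the right. *)
have : \sum_(i <- r) M%:R * (l i `^ p * (3 / 2)) <=
    M%:R * B / p * J + \sum_(i <- r) (1 - p^-1) * l i `^ p * (M%:R * (3 / 2)).
  have : \int[@lebesgue_measure R]_(t in `[0, 1]) (\sum_(i <- r)
        l i `^ (p - 1) * complex.Re (c i * (f t * vp_kernel M (x i - t)))) <=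
      \int[@lebesgue_measure R]_(t in `[0, 1]) (M%:R * B / p * cmod (f t) `^ p +
        \sum_(i <- r) (1 - p^-1) * l i `^ p * vp_majorant M (x i - t)).
    apply: le_Rintegral => //; last by apply: (integrableD _ iJ iR).
    by apply: continuous_integrable01; exact: continuous_sum_fun.
  rewrite RintegralD // RintegralZl //; last exact: integrable_powR_trigpoly (ltW p0).
  rewrite !Rintegral01_sum // => h; apply: le_trans (le_trans _ h) _.
    apply: ler_sum => i _; rewrite RintegralZl //; last first.
      by apply: continuous_integrable01; exact: continuous_trigpoly_vp.
    rewrite trigpoly_reproducing // cF -(powRB1_mul p1 (l0 i)) /l.
    by rewrite le_eqVlt; apply/orP; left; apply/eqP; field.
  rewrite lerD2l; apply: ler_sum => i _; rewrite RintegralZl ?Rintegral_vp_majorant //.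
  by apply: continuous_integrable01; exact: continuous_vp_majorant.
set S := \sum_(i <- r) l i `^ p.
have -> : \sum_(i <- r) M%:R * (l i `^ p * (3 / 2)) = M%:R * (3 / 2) * S.
  by rewrite mulr_sumr; apply: eq_bigr => i _; ring.
have -> : \sum_(i <- r) (1 - p^-1) * l i `^ p * (M%:R * (3 / 2)) =
    (1 - p^-1) * (M%:R * (3 / 2)) * S.
  by rewrite mulr_sumr; apply: eq_bigr => i _; ring.
move=> h.
have -> : \sum_(i <- r) cmod (f (x i)) `^ p = (3 / 2) `^ p * S.
  rewrite mulr_sumr; apply: eq_bigr => i _.
  by rewrite -powRM // /l [_ * (_ / _)]mulrC divfK.
rewrite -mulrA ler_wpM2l ?powR_ge0 //.
(* Absorbing the fraction 1 - 1/p leaves 1/p of the left side. *)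
have : M%:R / p * (3 / 2 * S) <= M%:R / p * (B * J).
  have -> : M%:R / p * (B * J) = M%:R * B / p * J by ring.
  have -> : M%:R / p * (3 / 2 * S) =
     M%:R * (3 / 2) * S - (1 - p^-1) * (M%:R * (3 / 2)) * S by ring.
  by rewrite lerBlDr.
rewrite ler_pM2l ?divr_gt0 //.
by lra.
Qed.

(** * Application to the exponential sum over A *)

Lemma truncate_le (R : realType) (A : set nat) (N : R) (k : nat) :
  truncate A N k -> (0 < k <= Num.trunc N)%N.
Proof.
move=> [_ /andP[k1 kN]]; rewrite ler1n in k1; rewrite k1 /=.
by rewrite truncn_ge_nat // (le_trans _ kN).
Qed.

Lemma finite_truncate (R : realType) (A : set nat) (N : R) :
  finite_set (truncate A N).
Proof.
apply: (@sub_finite_set _ _ `I_(Num.trunc N).+1); last exact: finite_II.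
by move=> k /truncate_le /andP[].
Qed.

Lemma counting_fun_le (R : realType) (A : set nat) (N : R) : 0 <= N ->
  (counting_fun A N)%:R <= N.
Proof.
move=> N0; rewrite -truncn_ge_nat //.
rewrite /counting_fun -[leqRHS](size_iota 1); apply: uniq_leq_size.
  exact: finmap.fset_uniq.
move=> k; rewrite in_fset_set; last exact: finite_truncate.
by move=> /set_mem /truncate_le; rewrite mem_iota add1n ltnS.
Qed.

Lemma expsum_trigpoly (R : realType) (A : set nat) (N t : R) :
  expsum A N t = trigpoly (fun=> 1) (finmap.enum_fset (fset_set (truncate A N))) t.
Proof.
rewrite /expsum fsbig_finite; last exact: finite_truncate.
by apply: eq_bigr => k _; rewrite mul1r.
Qed.

Theorem theorem1p6 (R : realType) (p : R) (A : set nat) (hp : 1 < p < 2)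
    (hA : strongly_subconvex p A) :
  exists C : R, \forall N \near +oo, forall q : nat, (0 < q)%N ->
    q%:R^-1 * \sum_(1 <= a < q.+1) cmod (expsum A N (a%:R / q%:R)) `^ p
      <= C * (N `^ (p - 1) + N `^ p / q%:R).
Proof.
move: hA => [_ _ [C hC]]; have /andP[p1 p2] := hp.
(* With B = (5 M + 3 q) / 2, the sieve factor B / (3/2) is at most (5/3) (N + q). The absolute value
   is taken because [C] has no given sign. *)
exists ((3 / 2) `^ p * (5 / 3) * `|C|); near=> N => q q0.
have N1 : 1 <= N by near: N; exact: nbhs_pinfty_ge.
have N0 : 0 < N by lra.
have qR : 0 < q%:R :> R by rewrite ltr0n.
set M := Num.trunc N; set s := finmap.enum_fset (fset_set (truncate A N)).
have M0 : (0 < M)%N by rewrite truncn_gt0.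
have MN : M%:R <= N by rewrite truncn_le ltW.
have sM : {in s, forall k, (k <= M)%N}.
  move=> k; rewrite in_fset_set; last exact: finite_truncate.
  by move=> /set_mem /truncate_le /andP[].
(* Subconvexity combined with A(N) <= N. *)
have hI : mean_value p A N <= `|C| * N `^ (p - 1).
  have : mean_value p A N <= C * (N^-1 * (counting_fun A N)%:R `^ p).
    by near: N.
  move=> /le_trans; apply.
  apply: (@le_trans _ _ (`|C| * (N^-1 * (counting_fun A N)%:R `^ p))).
    by rewrite ler_wpM2r ?ler_norm // mulr_ge0 ?powR_ge0 // invr_ge0 ltW.
  rewrite ler_wpM2l // -[leRHS](mulKf (lt0r_neq0 N0)) [N * _]mulrC powRB1_mul ?(ltW N0) //.
 rewrite ler_pM2l ?invr_gt0 //; apply: ge0_ler_powR; rewrite ?nnegrE ?(ltW N0) //.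
    by lra.
  exact: counting_fun_le (ltW N0).
have := @sum_powR_trigpoly_le R p ((5 * M%:R + 3 * q%:R) / 2) (fun=> 1) s M _
  (index_iota 1 q.+1) (fun a => a%:R / q%:R) p1 M0 sM
  (fun t => sum_vp_majorant_le M t q0).
have -> : \int[@lebesgue_measure R]_(t in `[0, 1])
    cmod (trigpoly (fun=> 1) s t) `^ p = mean_value p A N.
  by rewrite /mean_value; apply: eq_Rintegral => t _; rewrite expsum_trigpoly.
under eq_bigr do rewrite -expsum_trigpoly.
move=> h; rewrite ler_pdivrMl //; apply: le_trans h _.
have Np : N * N `^ (p - 1) = N `^ p by rewrite mulrC powRB1_mul ?(ltW N0).
rewrite -Np.
(* The target times q factors through (N + q) N^(p - 1), to be compared factor by factor with the
   sieve bound. *)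
have -> : q%:R * ((3 / 2) `^ p * (5 / 3) * `|C| *
    (N `^ (p - 1) + N * N `^ (p - 1) / q%:R)) =
    (3 / 2) `^ p * (5 / 3 * (N + q%:R)) * (`|C| * N `^ (p - 1)).
  by field; rewrite gt_eqF.
apply: ler_pM => //.
- by apply: Rintegral_ge0 => t _; exact: powR_ge0.
- by rewrite ler_wpM2l ?powR_ge0 //; lra.
Unshelve. all: by end_near.
Qed.
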